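(* Let $H$ be a complex Hilbert space, let $A,B\in\mathcal{B}(H)$ be accretive and let $\lambda\in(0,1)$. Then $$\Re\big(A\sharp_{\lambda}B\big)\ \geq\ (\Re A)\sharp_{\lambda}(\Re B).$$
   Context: $\mathcal{B}(H)$ is the algebra of bounded linear operators on $H$. A self-adjoint $A\in\mathcal{B}(H)$ is positive if $\langle Ax,x\rangle\ge 0$ for all $x\in H$, and strictly positive if it is positive and invertible; for self-adjoint $X,Y$, $X\ge Y$ means $X-Y$ is positive. $\Re A=(A+A^* )/2$; $A\in\mathcal{B}(H)$ is accretive if $\Re A$ is strictly positive (then $A$ is invertible and $A^{-1}$ is accretive; sums and positive multiples of accretive operators are accretive). For accretive $A,B$ and $\lambda\in(0,1)$ the $\lambda$-weighted geometric mean is $$A\sharp_{\lambda}B:=\frac{\sin(\lambda\pi)}{\pi}\int_0^{\infty}t^{\lambda-1}\big(A^{-1}+tB^{-1}\big)^{-1}dt,$$ an (improper) integral converging in operator norm. When $A,B$ are strictly positive this equals $A^{1/2}(A^{-1/2}BA^{-1/2})^{\lambda}A^{1/2}$. *)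

(* Defs.v *)
From Stdlib Require Import Reals Lra ClassicalEpsilon.
From Stdlib Require Import FunctionalExtensionality PropExtensionality ProofIrrelevance.
From Coquelicot Require Import Coquelicot.

Set Implicit Arguments.
Unset Strict Implicit.

Open Scope R_scope.

(* The inner product is linear in its first argument.  Positivity and
   definiteness follow from [inner_norm] and the axioms of [norm]. *)
Record Hilbert := {
  hilbert_space :> CompleteNormedModule C_AbsRing;
  inner : hilbert_space -> hilbert_space -> C;
  inner_plus_l : forall x y z, inner (plus x y) z = Cplus (inner x z) (inner y z);
  inner_scal_l : forall (k : C) x y, inner (scal k x) y = Cmult k (inner x y);
  inner_conj : forall x y, inner y x = Cconj (inner x y);
  inner_norm : forall x, inner x x = RtoC (norm x ^ 2)
}.

(* Coquelicot's [is_linear] includes boundedness.  Only real scalars act on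
   operators here, since Coquelicot integrates functions with values in
   normed modules over [R]. *)
Record bounded_op (U : NormedModule C_AbsRing) := Bop {
  bop_fun :> U -> U;
  bop_linear : is_linear bop_fun
}.

Section Operators.

Variable U : NormedModule C_AbsRing.

Implicit Types A B T : bounded_op U.

Lemma minus_plus_plus (G : AbelianGroup) (a b c d : G) :
  minus (plus a b) (plus c d) = plus (minus a c) (minus b d).
Proof.
unfold minus; rewrite opp_plus, <- !plus_assoc; f_equal.
rewrite !plus_assoc; f_equal; apply plus_comm.
Qed.

Lemma minus_plus_cancel (G : AbelianGroup) (x y : G) : x = plus y (minus x y).
Proof.
transitivity (plus x (plus (opp y) y)).
- rewrite plus_opp_l; symmetry; apply plus_zero_r.
- rewrite plus_assoc; apply plus_comm.
Qed.

Lemma bop_eq A B : (forall x, A x = B x) -> A = B.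
Proof.
destruct A as [f Hf], B as [g Hg]; simpl; intros H.
assert (E : f = g) by (apply functional_extensionality; exact H).
subst g; f_equal; apply proof_irrelevance.
Qed.

Definition bop_zero : bounded_op U := Bop (@is_linear_zero C_AbsRing U U).

Definition bop_one : bounded_op U := Bop (@is_linear_id C_AbsRing U).

Lemma bop_plus_linear A B : is_linear (fun x : U => plus (A x) (B x)).
Proof.
exact (is_linear_comp (fun x : U => (A x, B x)) (fun p => plus (fst p) (snd p))
  (is_linear_prod _ _ (bop_linear A) (bop_linear B)) is_linear_plus).
Qed.

Definition bop_plus A B : bounded_op U := Bop (bop_plus_linear A B).

Lemma bop_opp_linear A : is_linear (fun x : U => opp (A x)).
Proof.
exact (is_linear_comp A opp (bop_linear A) is_linear_opp).
Qed.

Definition bop_opp A : bounded_op U := Bop (bop_opp_linear A).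

Lemma bop_scal_linear (r : R) A : is_linear (fun x : U => scal (RtoC r : C_AbsRing) (A x)).
Proof.
apply (is_linear_comp A (fun y => scal (RtoC r : C_AbsRing) y) (bop_linear A)).
apply is_linear_scal_r; intros a b; apply Cmult_comm.
Qed.

Definition bop_scal (r : R) A : bounded_op U := Bop (bop_scal_linear r A).

Definition bop_comp A B : bounded_op U :=
  Bop (is_linear_comp B A (bop_linear B) (bop_linear A)).

Definition bop_AbelianMonoid_mixin : AbelianMonoid.mixin_of (bounded_op U).
Proof.
apply (@AbelianMonoid.Mixin (bounded_op U) bop_plus bop_zero);
  intros; apply bop_eq; intros; simpl.
- apply plus_comm.
- apply plus_assoc.
- apply plus_zero_r.
Defined.

Canonical bop_AbelianMonoid :=
  AbelianMonoid.Pack (bounded_op U) bop_AbelianMonoid_mixin (bounded_op U).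

Definition bop_AbelianGroup_mixin : AbelianGroup.mixin_of bop_AbelianMonoid.
Proof.
apply (@AbelianGroup.Mixin bop_AbelianMonoid bop_opp).
intros A; apply bop_eq; intros x; exact (plus_opp_r (A x)).
Defined.

Canonical bop_AbelianGroup :=
  AbelianGroup.Pack (bounded_op U) (AbelianGroup.Class _ _ bop_AbelianGroup_mixin)
    (bounded_op U).

Definition bop_ModuleSpace_mixin : ModuleSpace.mixin_of R_Ring bop_AbelianGroup.
Proof.
apply (@ModuleSpace.Mixin R_Ring bop_AbelianGroup bop_scal);
  intros; apply bop_eq; intros y0; simpl.
- rewrite (scal_assoc (V := U)); f_equal; exact (eq_sym (RtoC_mult x y)).
- exact (scal_one (K := C_Ring) (u y0)).
- exact (scal_distr_l (K := C_Ring) (RtoC x) (u y0) (v y0)).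
- etransitivity; [|exact (scal_distr_r (K := C_Ring) (RtoC x) (RtoC y) (u y0))].
  f_equal; exact (RtoC_plus x y).
Defined.

Canonical bop_ModuleSpace :=
  ModuleSpace.Pack R_Ring (bounded_op U)
    (ModuleSpace.Class _ _ _ bop_ModuleSpace_mixin) (bounded_op U).

Definition opnorm A : R :=
  real (Lub_Rbar (fun r => exists x : U, norm x <= 1 /\ r = norm (A x))).

Lemma opnorm_lub A :
  (forall x : U, norm x <= 1 -> norm (A x) <= opnorm A) /\
  (forall M, (forall x : U, norm x <= 1 -> norm (A x) <= M) -> opnorm A <= M).
Proof.
destruct (linear_norm _ (bop_linear A)) as [M [HM HA]].
unfold opnorm.
set (E := fun r => _).
destruct (Lub_Rbar_correct E) as [Hub Hl].
assert (H0 : Rbar_le 0 (Lub_Rbar E)).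
{ apply Hub; exists zero; split.
  - rewrite norm_zero; lra.
  - rewrite (linear_zero _ (bop_linear A)), norm_zero; reflexivity. }
assert (H1 : Rbar_le (Lub_Rbar E) M).
{ apply Hl; intros r [x [Hx ->]]; simpl.
  apply Rle_trans with (1 := HA x).
  rewrite <- (Rmult_1_r M) at 2; apply Rmult_le_compat_l; lra. }
assert (HF : Lub_Rbar E = Finite (real (Lub_Rbar E))).
{ destruct (Lub_Rbar E); simpl in *; try reflexivity; contradiction. }
split.
- intros x Hx; change (Rbar_le (norm (A x)) (real (Lub_Rbar E))).
  rewrite <- HF; apply Hub; exists x; split; trivial.
- intros N HN; change (Rbar_le (real (Lub_Rbar E)) N).
  rewrite <- HF; apply Hl; intros r [x [Hx ->]]; apply HN, Hx.
Qed.

Lemma opnorm_ge0 A : 0 <= opnorm A.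
Proof.
apply Rle_trans with (norm (A zero)); [apply norm_ge_0|].
apply opnorm_lub; rewrite norm_zero; lra.
Qed.

Lemma norm_scal_RtoC (r : R) (x : U) :
  norm (scal (RtoC r : C_AbsRing) x) <= Rabs r * norm x.
Proof. rewrite <- Cmod_R; apply (norm_scal (K := C_AbsRing)). Qed.

Lemma opnorm_bound A (x : U) : norm (A x) <= opnorm A * norm x.
Proof.
destruct (Req_dec (norm x) 0) as [H|H].
- rewrite (norm_eq_zero _ H), (linear_zero _ (bop_linear A)), !norm_zero; lra.
- assert (Hp : 0 < norm x) by (destruct (norm_ge_0 x); congruence || lra).
  pose (y := scal (RtoC (/ norm x) : C_AbsRing) x).
  assert (Hy : norm y <= 1).
  { apply Rle_trans with (1 := norm_scal_RtoC _ _).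
    rewrite Rabs_pos_eq; [rewrite Rinv_l; lra|].
    apply Rlt_le, Rinv_0_lt_compat, Hp. }
  assert (Hx : x = scal (RtoC (norm x) : C_AbsRing) y).
  { unfold y; rewrite scal_assoc.
    change (mult (RtoC (norm x) : C_AbsRing) (RtoC (/ norm x)))
      with (Cmult (RtoC (norm x)) (RtoC (/ norm x))).
    rewrite <- RtoC_mult, Rinv_r by exact H.
    symmetry; apply (scal_one (K := C_Ring)). }
  rewrite Hx at 1.
  rewrite (linear_scal _ (bop_linear A)).
  apply Rle_trans with (1 := norm_scal_RtoC _ _).
  rewrite Rabs_pos_eq by lra.
  rewrite Rmult_comm; apply Rmult_le_compat_r; [lra|].
  apply opnorm_lub, Hy.
Qed.

Lemma opnorm_le A M :
  0 <= M -> (forall x : U, norm (A x) <= M * norm x) -> opnorm A <= M.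
Proof.
intros HM H; apply opnorm_lub; intros x Hx.
apply Rle_trans with (1 := H x).
rewrite <- (Rmult_1_r M) at 2; apply Rmult_le_compat_l; lra.
Qed.

Lemma opnorm_triangle A B : opnorm (plus A B) <= opnorm A + opnorm B.
Proof.
apply opnorm_le.
- generalize (opnorm_ge0 A) (opnorm_ge0 B); lra.
- intros x; apply Rle_trans with (1 := norm_triangle (A x) (B x)).
  generalize (opnorm_bound A x) (opnorm_bound B x); lra.
Qed.

Lemma opnorm_scal (r : R) A : opnorm (scal r A) <= Rabs r * opnorm A.
Proof.
apply opnorm_le.
- apply Rmult_le_pos; [apply Rabs_pos | apply opnorm_ge0].
- intros x; apply Rle_trans with (1 := norm_scal_RtoC _ _).
  rewrite Rmult_assoc; apply Rmult_le_compat_l;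
    [apply Rabs_pos | apply opnorm_bound].
Qed.

Lemma opnorm_opp A : opnorm (opp A) = opnorm A.
Proof.
assert (H : forall B, opnorm (opp B) <= opnorm B).
{ intros B; apply opnorm_le; [apply opnorm_ge0|].
  intros x; change (opp B x) with (opp (B x)).
  rewrite (norm_opp (B x)); apply opnorm_bound. }
apply Rle_antisym; [apply H|].
rewrite <- (opp_opp A) at 1; apply H.
Qed.

Lemma opnorm_eq0 A : opnorm A = 0 -> A = zero.
Proof.
intros H; apply bop_eq; intros x; change ((zero : bounded_op U) x) with (zero : U).
apply norm_eq_zero, Rle_antisym; [|apply norm_ge_0].
generalize (opnorm_bound A x); rewrite H; lra.
Qed.

Definition bop_ball A (e : R) B : Prop := opnorm (minus B A) < e.

Definition bop_UniformSpace_mixin : UniformSpace.mixin_of (bounded_op U).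
Proof.
apply (@UniformSpace.Mixin (bounded_op U) bop_zero bop_ball); unfold bop_ball.
- intros A e; rewrite minus_eq_zero.
  apply Rle_lt_trans with 0; [|apply cond_pos].
  apply opnorm_le; [lra|].
  intros x; change ((zero : bounded_op U) x) with (zero : U); rewrite norm_zero; lra.
- intros A B e; rewrite <- (opp_minus A B), opnorm_opp; trivial.
- intros A B T e1 e2 H1 H2; rewrite (minus_trans B T A).
  apply Rle_lt_trans with (1 := opnorm_triangle _ _); lra.
Defined.

Canonical bop_UniformSpace :=
  UniformSpace.Pack (bounded_op U) bop_UniformSpace_mixin (bounded_op U).

Canonical bop_NormedModuleAux :=
  NormedModuleAux.Pack R_AbsRing (bounded_op U)
    (NormedModuleAux.Class R_AbsRing _
      (ModuleSpace.class _ bop_ModuleSpace) bop_UniformSpace_mixin) (bounded_op U).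

Definition bop_NormedModule_mixin :
  NormedModule.mixin_of R_AbsRing bop_NormedModuleAux.
Proof.
apply (@NormedModule.Mixin R_AbsRing bop_NormedModuleAux opnorm 1).
- exact opnorm_triangle.
- exact opnorm_scal.
- intros A B e H; exact H.
- intros A B e H; rewrite Rmult_1_l; exact H.
- exact opnorm_eq0.
Defined.

Canonical bop_NormedModule :=
  NormedModule.Pack R_AbsRing (bounded_op U)
    (NormedModule.Class _ _ _ bop_NormedModule_mixin) (bounded_op U).

Definition bop_lim (F : (bounded_op U -> Prop) -> Prop) : bounded_op U :=
  epsilon (inhabits bop_zero) (fun A => forall e : posreal, F (ball A e)).

Lemma norm_minus_small (x y : U) :
  (forall e : posreal, norm (minus x y) <= e) -> x = y.
Proof.
intros H; apply (plus_reg_r (opp y)).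
rewrite plus_opp_r; apply norm_eq_zero, Rle_antisym; [|apply norm_ge_0].
apply le_epsilon; intros e He; rewrite Rplus_0_l; exact (H (mkposreal e He)).
Qed.

Lemma norm_minus_sym (x y : U) : norm (minus x y) = norm (minus y x).
Proof. rewrite <- (norm_opp (minus y x)); f_equal; symmetry; apply opp_minus. Qed.

Lemma norm_minus_triangle (x y z : U) :
  norm (minus x z) <= norm (minus x y) + norm (minus y z).
Proof. rewrite (minus_trans y x z); exact (norm_triangle _ _). Qed.

Lemma norm_minus_plus (a b c d : U) :
  norm (minus (plus a b) (plus c d)) <= norm (minus a c) + norm (minus b d).
Proof.
apply Rle_trans with (2 := norm_triangle _ _); right; f_equal.
exact (minus_plus_plus a b c d).
Qed.

Lemma norm_le_minus (x y : U) : norm x <= norm y + norm (minus x y).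
Proof.
apply Rle_trans with (2 := norm_triangle _ _); right; f_equal.
exact (minus_plus_cancel x y).
Qed.

Lemma bop_complete (F : (bounded_op U -> Prop) -> Prop) :
  (forall G : (U -> Prop) -> Prop, ProperFilter G -> cauchy G ->
    exists l : U, forall e : posreal, G (ball l e)) ->
  ProperFilter F -> cauchy F -> exists A, forall e : posreal, F (ball A e).
Proof.
intros HU PF CF.
pose (Fx := fun (x : U) => filtermap (fun T : bounded_op U => T x) F).
pose (L := fun x : U =>
  epsilon (inhabits (zero : U)) (fun l => forall e : posreal, Fx x (ball l e))).
assert (HL : forall (x : U) (e : posreal), F (fun T => norm (minus (T x) (L x)) < e)).
{ intros x e.
  pose proof (norm_factor_gt_0 (V := U)) as Hnf.
  assert (He : 0 < e / @norm_factor _ U)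
    by (apply Rdiv_lt_0_compat; [apply cond_pos | exact Hnf]).
  assert (HC : Fx x (ball (L x) (mkposreal _ He))).
  { unfold L; cut (exists l : U, forall e0 : posreal, Fx x (ball l e0)).
    { intros Hl; exact (epsilon_spec _ _ Hl (mkposreal _ He)). }
    apply HU; [apply filtermap_proper_filter, PF|].
    intros d.
    assert (Hd : 0 < d / (norm x + 1)).
    { apply Rdiv_lt_0_compat; [apply cond_pos|].
      generalize (norm_ge_0 x); lra. }
    destruct (CF (mkposreal _ Hd)) as [T0 HT0].
    exists (T0 x); unfold Fx, filtermap.
    apply filter_imp with (2 := HT0); intros T HT.
    apply (norm_compat1 (V := U)).
    apply Rle_lt_trans with (1 := opnorm_bound (minus T T0) x).
    change (opnorm (minus T T0) < d / (norm x + 1)) in HT.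
    assert (Hx := norm_ge_0 x).
    apply Rle_lt_trans with (d / (norm x + 1) * norm x).
    - apply Rmult_le_compat_r; lra.
    - apply Rlt_le_trans with (d / (norm x + 1) * (norm x + 1)).
      + apply Rmult_lt_compat_l; [exact Hd | lra].
      + right; field; lra. }
  unfold Fx, filtermap in HC.
  apply filter_imp with (2 := HC); intros T HT.
  apply (norm_compat2 (V := U)) in HT; simpl in HT.
  replace (pos e) with (@norm_factor _ U * (e / @norm_factor _ U)) by (field; lra).
  exact HT. }
assert (Lplus : forall x y, L (plus x y) = plus (L x) (L y)).
{ intros x y; apply norm_minus_small; intros e.
  assert (He : 0 < e / 3) by (generalize (cond_pos e); lra).
  destruct (filter_ex _ (filter_and _ _ (HL (plus x y) (mkposreal _ He))
    (filter_and _ _ (HL x (mkposreal _ He)) (HL y (mkposreal _ He)))))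
    as [T [H1 [H2 H3]]]; simpl in *.
  rewrite (linear_plus _ (bop_linear T)), norm_minus_sym in H1.
  generalize (norm_minus_triangle (L (plus x y)) (plus (T x) (T y)) (plus (L x) (L y)))
    (norm_minus_plus (T x) (T y) (L x) (L y)); lra. }
assert (Lscal : forall (k : C_AbsRing) x, L (scal k x) = scal k (L x)).
{ intros k x; apply norm_minus_small; intros e.
  assert (Hk := abs_ge_0 k).
  assert (He : 0 < e / 2) by (generalize (cond_pos e); lra).
  assert (Hek : 0 < e / 2 / (abs k + 1)) by (apply Rdiv_lt_0_compat; lra).
  destruct (filter_ex _ (filter_and _ _ (HL (scal k x) (mkposreal _ He))
    (HL x (mkposreal _ Hek)))) as [T [H1 H2]]; simpl in *.
  rewrite (linear_scal _ (bop_linear T)), norm_minus_sym in H1.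
  assert (H3 : norm (minus (scal k (T x)) (scal k (L x))) <=
      abs k * norm (minus (T x) (L x))).
  { apply Rle_trans with (2 := norm_scal k (minus (T x) (L x))).
    right; symmetry; exact (f_equal norm (scal_minus_distr_l k (T x) (L x))). }
  assert (H4 : abs k * norm (minus (T x) (L x)) <= e / 2).
  { apply Rle_trans with ((abs k + 1) * (e / 2 / (abs k + 1))).
    - apply Rmult_le_compat; try lra; apply norm_ge_0.
    - right; field; lra. }
  apply Rle_trans with (1 := norm_minus_triangle _ (scal k (T x)) _).
  apply Rle_trans with (e / 2 + e / 2); [apply Rplus_le_compat | lra].
  - apply Rlt_le; exact H1.
  - exact (Rle_trans _ _ _ H3 H4). }
assert (LB : exists M, 0 < M /\ forall x, norm (L x) <= M * norm x).
{ destruct (CF (mkposreal 1 Rlt_0_1)) as [T0 HT0].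
  exists (opnorm T0 + 1); split; [generalize (opnorm_ge0 T0); lra|].
  intros x; apply le_epsilon; intros e He.
  destruct (filter_ex _ (filter_and _ _ HT0 (HL x (mkposreal _ He))))
    as [T [H1 H2]]; simpl in *.
  change (opnorm (minus T T0) < 1) in H1.
  assert (H3 := norm_le_minus (T x) (T0 x)).
  assert (H4 := opnorm_bound T0 x).
  assert (H5 := opnorm_bound (minus T T0) x).
  change (minus T T0 x) with (minus (T x) (T0 x)) in H5.
  assert (H6 : opnorm (minus T T0) * norm x <= 1 * norm x)
    by (apply Rmult_le_compat_r; [apply norm_ge_0 | lra]).
  rewrite norm_minus_sym in H2.
  generalize (norm_le_minus (L x) (T x)); lra. }
pose (A := Bop (Build_is_linear L Lplus Lscal LB)).
exists A; intros e.
assert (He : 0 < e / 4) by (generalize (cond_pos e); lra).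
destruct (CF (mkposreal _ He)) as [T0 HT0].
apply filter_imp with (2 := HT0); intros T HT.
change (opnorm (minus T T0) < e / 4) in HT.
change (opnorm (minus T A) < e).
apply Rle_lt_trans with (e / 2); [|generalize (cond_pos e); lra].
apply opnorm_le; [lra|].
intros x; apply le_epsilon; intros d Hd.
destruct (filter_ex _ (filter_and _ _ HT0 (HL x (mkposreal _ Hd))))
  as [T' [H1 H2]]; simpl in *.
change (opnorm (minus T' T0) < e / 4) in H1.
change (norm (minus (T x) (L x)) <= e / 2 * norm x + d).
generalize (norm_minus_triangle (T x) (T' x) (L x))
  (norm_minus_triangle (T x) (T0 x) (T' x)).
rewrite (norm_minus_sym (T0 x) (T' x)).
assert (H4 : forall S, opnorm (minus S T0) < e / 4 ->
          norm (minus (S x) (T0 x)) <= e / 4 * norm x).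
{ intros S HS; eapply Rle_trans; [exact (opnorm_bound (minus S T0) x)|].
  apply Rmult_le_compat_r; [apply norm_ge_0 | lra]. }
generalize (H4 _ HT) (H4 _ H1); lra.
Qed.

Definition is_inverse A B : Prop :=
  bop_comp A B = bop_one /\ bop_comp B A = bop_one.

Definition invertible_op A : Prop := exists B, is_inverse A B.

(* Arbitrary when [A] is not invertible. *)
Definition bop_inv A : bounded_op U := epsilon (inhabits bop_zero) (is_inverse A).

End Operators.

Section Complete.

Variable W : CompleteNormedModule C_AbsRing.

Definition bop_CompleteSpace_mixin : CompleteSpace.mixin_of (bop_UniformSpace W).
Proof.
apply (@CompleteSpace.Mixin (bop_UniformSpace W) (@bop_lim W)).
- intros F PF CF; unfold bop_lim; apply epsilon_spec; apply bop_complete; trivial.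
  intros G PG CG; exists (lim G); exact (complete_cauchy (T := W) G PG CG).
- intros F G H1 H2 e.
  replace G with F; [apply ball_center|].
  apply functional_extensionality; intros P; apply propositional_extensionality.
  split; [apply H2 | apply H1].
Defined.

Canonical bop_CompleteSpace :=
  CompleteSpace.Pack (bounded_op W)
    (CompleteSpace.Class _ _ bop_CompleteSpace_mixin) (bounded_op W).

Canonical bop_CompleteNormedModule :=
  CompleteNormedModule.Pack R_AbsRing (bounded_op W)
    (CompleteNormedModule.Class R_AbsRing _
      (NormedModule.class _ (bop_NormedModule W)) bop_CompleteSpace_mixin) (bounded_op W).

End Complete.

Section Accretive.

Variable H : Hilbert.

Implicit Types A B X Y : bounded_op H.

Definition is_adjoint A B : Prop :=
  forall x y : H, inner (A x) y = inner x (B y).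

(* The adjoint exists by the Riesz representation theorem and is unique, so
   the choice made by [epsilon] is immaterial. *)
Definition adjoint A : bounded_op H := epsilon (inhabits (bop_zero H)) (is_adjoint A).

Definition selfadjoint A : Prop := adjoint A = A.

(* [inner (A x) x] is real for self-adjoint [A], hence the projection [Re]. *)
Definition positive_op A : Prop :=
  selfadjoint A /\ forall x : H, 0 <= Re (inner (A x) x).

Definition strictly_positive_op A : Prop := positive_op A /\ invertible_op A.

Definition bop_ge X Y : Prop := positive_op (minus X Y).

Definition bop_Re A : bounded_op H := scal (1 / 2) (plus A (adjoint A)).

Definition accretive A : Prop := strictly_positive_op (bop_Re A).

(* [RInt_gen] is an improper Riemann integral, taken here in the Banach space
   [bounded_op H], so its limit at both ends is a limit in operator norm. *)
Definition gmean (l : R) A B : bounded_op H :=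
  scal (sin (l * PI) / PI)
    (RInt_gen
      (fun t : R =>
        scal (Rpower t (l - 1))
          (bop_inv (plus (bop_inv A) (scal t (bop_inv B)))))
      (at_right 0) (Rbar_locally p_infty)).

End Accretive.

(* Main.v *)
Require Import Defs.
From Stdlib Require Import Reals Lra Psatz Classical ClassicalEpsilon.
From Coquelicot Require Import Coquelicot.
Open Scope R_scope.

(** The inequality holds integrand by integrand.  Write [pencil A B t] for
    [A^-1 + t B^-1], and let [P], [Q] be the real parts of [A], [B].  For
    [t > 0] and a vector [x],

      Re <(P^-1 + t Q^-1)^-1 x, x>  <=  Re <(A^-1 + t B^-1)^-1 x, x>.

    The left-hand side is a parallel sum, and the parallel sum of positive
    operators is a minimum over decompositions:

      <(P^-1 + t Q^-1)^-1 x, x>  =  min over y + z = x of <P y, y> + <Q z, z> / t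

    ([parallel_sum_le] is the inequality between the two sides).  An accretive
    pair supplies a competitor for this minimum: with
    [w = (A^-1 + t B^-1)^-1 x], the vectors [y = A^-1 w] and [z = t B^-1 w] add
    up to [x], and [Re <w, x> = Re <A y, y> + Re <B z, z> / t], where [A] and
    [B] may be replaced by their real parts ([accretive_pencil_inv_ge]).
    Integrating against the nonnegative weight [t^(l-1)] gives the theorem.

    Three facts about Hilbert space operators support this.  Adjoints exist, by
    the Riesz representation theorem; hence [bop_Re] really produces the
    self-adjoint part.  A strictly positive operator is bounded below, so an
    accretive operator is [coercive], and coercive operators are invertible
    (Lax-Milgram) with coercive inverse; hence the pencil is coercive with a
    constant growing like [1 + t].  Finally the integrand is norm continuous
    and dominated by [t^(l-1)] near 0 and [t^(l-2)] near infinity, so the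
    improper integral converges in operator norm ([gmean_converges]); bounded
    linear functionals such as [T |-> Re <T x, y>] then pass through it. *)

(** * Linear maps and improper integrals *)

Lemma Riemann_sum_linear (V W : NormedModule R_AbsRing) (phi : V -> W) (f : R -> V)
    (ptd : @SF_seq R) :
  is_linear phi ->
  Riemann_sum (fun t => phi (f t)) ptd = phi (Riemann_sum f ptd).
Proof.
intros Hphi; revert ptd; apply SF_cons_ind; [intros x0 | intros h s IH].
- symmetry; apply (linear_zero _ Hphi).
- rewrite !Riemann_sum_cons, IH, (linear_plus _ Hphi), (linear_scal _ Hphi); reflexivity.
Qed.

Lemma is_RInt_linear (V W : NormedModule R_AbsRing) (phi : V -> W) (f : R -> V)
    (a b : R) (I : V) :
  is_linear phi -> is_RInt f a b I -> is_RInt (fun t => phi (f t)) a b (phi I).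
Proof.
intros Hphi HI.
apply filterlim_ext with
  (fun ptd => phi (scal (sign (b - a)) (Riemann_sum f ptd))).
- intros ptd.
  rewrite (linear_scal _ Hphi), (Riemann_sum_linear _ _ _ _ _ Hphi); reflexivity.
- exact (filterlim_comp _ _ _ _ phi _ _ _ HI (linear_cont phi I Hphi)).
Qed.

Lemma is_RInt_gen_linear (V W : NormedModule R_AbsRing) (phi : V -> W) (f : R -> V)
    (Fa Fb : (R -> Prop) -> Prop) (FFa : Filter Fa) (FFb : Filter Fb) (I : V) :
  is_linear phi -> is_RInt_gen f Fa Fb I ->
  is_RInt_gen (fun t => phi (f t)) Fa Fb (phi I).
Proof.
intros Hphi HI P HP.
pose proof (HI _ (linear_cont phi I Hphi P HP)) as K.
unfold filtermapi in *; generalize K; apply filter_imp.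
intros [a b] [y [Hy HPy]]; exists (phi y); split; [|exact HPy].
exact (is_RInt_linear _ _ _ _ _ _ _ Hphi Hy).
Qed.

(** Comparison with the zero function, through the norm inequality for
    improper integrals. *)
Lemma is_RInt_gen_ge0 (Fa Fb : (R -> Prop) -> Prop) (FFa : ProperFilter Fa)
    (FFb : ProperFilter Fb) (f : R -> R) (I : R) :
  filter_prod Fa Fb (fun ab => fst ab <= snd ab) ->
  filter_prod Fa Fb (fun ab => forall t, fst ab <= t <= snd ab -> 0 <= f t) ->
  is_RInt_gen f Fa Fb I -> 0 <= I.
Proof.
intros Hab Hf HI.
replace 0 with (norm (scal 0 I : R)) at 1.
2: { change (Rabs (0 * I) = 0); rewrite Rmult_0_l; apply Rabs_R0. }
apply (RInt_gen_norm (fun t => scal 0 (f t) : R) f (scal 0 I : R) I Hab); trivial.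
- generalize Hf; apply filter_imp; intros ab H t Ht.
  change (Rabs (0 * f t) <= f t); rewrite Rmult_0_l, Rabs_R0; auto.
- exact (is_RInt_gen_scal (V := R_NormedModule) f 0 I HI).
Qed.

(** The absolute value makes the bound usable for both orders of [a] and [b];
    the set [D] is an interval on which the primitive [G] of the majorant is
    known. *)
Lemma norm_is_RInt_le (V : NormedModule R_AbsRing) (f : R -> V) (g G : R -> R)
    (D : R -> Prop) (a b : R) (I : V) :
  (forall x y t, D x -> D y -> x <= t <= y -> D t) ->
  (forall t, D t -> is_derive G t (g t)) ->
  (forall t, D t -> continuous g t) ->
  (forall t, D t -> norm (f t) <= g t) ->
  D a -> D b -> is_RInt f a b I -> norm I <= Rabs (G b - G a).
Proof.
intros HD HG Hg Hfg.
assert (Hle : forall a b I, a <= b -> D a -> D b -> is_RInt f a b I ->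
    norm I <= Rabs (G b - G a)).
{ clear a b I; intros a b I Hab Ha Hb HI.
  apply Rle_trans with (2 := Rle_abs _).
  apply (norm_RInt_le f g a b I (G b - G a) Hab); trivial.
  - intros t Ht; apply Hfg, (HD a b); trivial.
  - apply (is_RInt_derive G g); intros t; rewrite Rmin_left, Rmax_right by exact Hab;
      intros Ht; [apply HG | apply Hg]; apply (HD a b); trivial. }
intros Ha Hb HI; destruct (Rle_dec a b) as [Hab|Hab]; [apply Hle; trivial|].
rewrite <- (norm_opp I), Rabs_minus_sym.
apply Hle; trivial; [lra|].
exact (is_RInt_swap _ _ _ _ HI).
Qed.

Lemma minus_plus_middle (G : AbelianGroup) (x y z : G) :
  minus (plus (plus x y) z) y = plus x z.
Proof.
unfold minus; rewrite <- plus_assoc, <- plus_assoc; f_equal.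
rewrite (plus_comm z), plus_assoc.
transitivity (plus zero z); [f_equal; apply plus_opp_r | apply plus_zero_l].
Qed.

(** Cauchy criterion: the integrals over [a, b] and [a', b'] differ by
    integrals over [a', a] and [b, b'], which are small because the primitive
    [G] of the majorant converges at both ends. *)
Lemma ex_RInt_gen_dominated (V : CompleteNormedModule R_AbsRing) (f : R -> V)
    (g G : R -> R) (D : R -> Prop) (Fa Fb : (R -> Prop) -> Prop)
    (FFa : ProperFilter Fa) (FFb : ProperFilter Fb) (la lb : R) :
  (forall x y t, D x -> D y -> x <= t <= y -> D t) ->
  (forall t, D t -> is_derive G t (g t)) ->
  (forall t, D t -> continuous g t) ->
  (forall t, D t -> continuous f t) ->
  (forall t, D t -> norm (f t) <= g t) ->
  Fa D -> Fb D ->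
  filterlim G Fa (locally la) -> filterlim G Fb (locally lb) ->
  ex_RInt_gen f Fa Fb.
Proof.
intros HD HG Hg Hf Hfg HFa HFb Hla Hlb.
assert (Hex : forall a b, D a -> D b -> ex_RInt f a b).
{ intros a b Ha Hb; apply ex_RInt_continuous; intros t Ht; apply Hf.
  destruct (Rle_dec a b).
  - rewrite Rmin_left, Rmax_right in Ht by lra; apply (HD a b); trivial.
  - rewrite Rmin_right, Rmax_left in Ht by lra; apply (HD b a); trivial. }
assert (Hlim : exists I : V,
    filterlim (fun ab => RInt f (fst ab) (snd ab)) (filter_prod Fa Fb) (locally I)).
{ apply (proj1 (filterlim_locally_cauchy (U := V) (F := filter_prod Fa Fb)
    (fun ab => RInt f (fst ab) (snd ab)))); intros eps.
  assert (He : 0 < eps / 4) by (generalize (cond_pos eps); lra).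
  pose (e := mkposreal _ He).
  pose proof (proj1 (filterlim_locally G la) Hla e) as Ha.
  pose proof (proj1 (filterlim_locally G lb) Hlb e) as Hb.
  exists (fun ab => (D (fst ab) /\ ball la e (G (fst ab))) /\
                    (D (snd ab) /\ ball lb e (G (snd ab)))).
  split.
  { apply Filter_prod with (fun a => D a /\ ball la e (G a))
      (fun b => D b /\ ball lb e (G b)); try (apply filter_and; trivial).
    intros a b H1 H2; split; trivial. }
  intros [a b] [a' b']; simpl; intros [[Da Ba] [Db Bb]] [[Da' Ba'] [Db' Bb']].
  apply (norm_compat1 (V := V)).
  assert (Ea : is_RInt f a' a (RInt f a' a)) by (apply RInt_correct, Hex; trivial).
  assert (Eb : is_RInt f b b' (RInt f b b')) by (apply RInt_correct, Hex; trivial).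
  assert (Eab : is_RInt f a b (RInt f a b)) by (apply RInt_correct, Hex; trivial).
  assert (E : RInt f a' b' = plus (plus (RInt f a' a) (RInt f a b)) (RInt f b b')).
  { apply is_RInt_unique.
    exact (is_RInt_Chasles _ _ _ _ _ _ (is_RInt_Chasles _ _ _ _ _ _ Ea Eab) Eb). }
  assert (E' : minus (RInt f a' b') (RInt f a b) = plus (RInt f a' a) (RInt f b b')).
  { rewrite E; apply (minus_plus_middle V). }
  apply Rle_lt_trans with (norm (RInt f a' a) + norm (RInt f b b')).
  { apply Rle_trans with (2 := norm_triangle _ _); right; exact (f_equal norm E'). }
  generalize (norm_is_RInt_le _ _ _ _ _ _ _ _ HD HG Hg Hfg Da' Da Ea)
    (norm_is_RInt_le _ _ _ _ _ _ _ _ HD HG Hg Hfg Db Db' Eb).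
  change (Rabs (G a - la) < eps / 4) in Ba; change (Rabs (G a' - la) < eps / 4) in Ba'.
  change (Rabs (G b - lb) < eps / 4) in Bb; change (Rabs (G b' - lb) < eps / 4) in Bb'.
  apply Rabs_def2 in Ba; apply Rabs_def2 in Ba'.
  apply Rabs_def2 in Bb; apply Rabs_def2 in Bb'.
  assert (Rabs (G a - G a') < eps / 2) by (apply Rabs_def1; lra).
  assert (Rabs (G b' - G b) < eps / 2) by (apply Rabs_def1; lra).
  lra. }
destruct Hlim as [I HI]; exists I; intros P HP.
unfold filtermapi.
assert (HDD : filter_prod Fa Fb (fun ab => D (fst ab) /\ D (snd ab))).
{ apply Filter_prod with D D; trivial; intros; split; trivial. }
specialize (HI P HP); unfold filtermap in HI.
generalize (filter_and _ _ HI HDD); apply filter_imp.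
intros [a b] [HPab [Da Db]]; exists (RInt f a b); split; trivial.
apply RInt_correct, Hex; trivial.
Qed.

Lemma is_derive_Rpower (a c t : R) :
  a <> 0 -> 0 < t ->
  is_derive (fun x => c * Rpower x a / a) t (c * Rpower t (a - 1)).
Proof.
intros Ha Ht; apply is_derive_Reals.
replace (c * Rpower t (a - 1)) with (c / a * (a * Rpower t (a - 1))) by (field; exact Ha).
apply derivable_pt_lim_ext with (fun x => c / a * Rpower x a).
- intros x; field; exact Ha.
- apply derivable_pt_lim_scal, derivable_pt_lim_power, Ht.
Qed.

Lemma continuous_Rpower (a t : R) : 0 < t -> continuous (fun x => Rpower x a) t.
Proof.
intros Ht; apply (ex_derive_continuous (V := R_NormedModule)).
exists (a * Rpower t (a - 1)); apply is_derive_Reals, derivable_pt_lim_power, Ht.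
Qed.

Lemma filterlim_exp_minfty (F : (R -> Prop) -> Prop) (FF : Filter F) (h : R -> R) :
  filterlim h F (Rbar_locally m_infty) -> filterlim (fun x => exp (h x)) F (locally 0).
Proof. intros Hh; exact (filterlim_comp _ _ _ h exp _ _ _ Hh is_lim_exp_m). Qed.

Lemma Rpower_lim_0 (a : R) :
  0 < a -> filterlim (fun x => Rpower x a) (at_right 0) (locally 0).
Proof.
intros Ha; unfold Rpower; apply filterlim_exp_minfty; [typeclasses eauto|].
intros P [M HM].
pose proof (is_lim_ln_0 (fun y => y < M / a) (ex_intro _ (M / a) (fun _ H => H))) as H.
unfold filtermap in *.
generalize H; apply filter_imp; intros x Hx; apply HM.
apply (Rmult_lt_compat_l a) in Hx; [|exact Ha].
replace (a * (M / a)) with M in Hx by (field; lra); exact Hx.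
Qed.

Lemma Rpower_lim_infty (a : R) :
  a < 0 -> filterlim (fun x => Rpower x a) (Rbar_locally p_infty) (locally 0).
Proof.
intros Ha; unfold Rpower; apply filterlim_exp_minfty; [typeclasses eauto|].
intros P [M HM].
pose proof (is_lim_ln_p (fun y => M / a < y) (ex_intro _ (M / a) (fun _ H => H))) as H.
unfold filtermap in *.
generalize H; apply filter_imp; intros x Hx; apply HM.
apply (Rmult_lt_gt_compat_neg_l a) in Hx; [|exact Ha].
replace (a * (M / a)) with M in Hx by (field; lra); exact Hx.
Qed.

Lemma filterlim_mult_div (F : (R -> Prop) -> Prop) (FF : Filter F) (h : R -> R) (c a : R) :
  filterlim h F (locally 0) -> filterlim (fun x => c * h x / a) F (locally (c * 0 / a)).
Proof.
intros Hh.
apply (filterlim_comp _ _ _ h (fun y => c * y / a) _ (locally 0) _ Hh).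
apply (ex_derive_continuous (V := R_NormedModule) (fun y => c * y / a) 0); auto_derive; trivial.
Qed.

(** The half-line is cut at 1: the weighted function is dominated by
    [M t^(l-1)] on the left and, thanks to the decay [M / t], by [M t^(l-2)] on
    the right; both have power primitives with a limit at the open end. *)
Lemma ex_RInt_gen_power_weight (V : CompleteNormedModule R_AbsRing) (f : R -> V)
    (l M : R) :
  0 < l < 1 ->
  (forall t, 0 < t -> continuous f t) ->
  (forall t, 0 < t -> norm (f t) <= M) ->
  (forall t, 0 < t -> t * norm (f t) <= M) ->
  ex_RInt_gen (fun t => scal (Rpower t (l - 1)) (f t)) (at_right 0) (Rbar_locally p_infty).
Proof.
intros Hl Hf H0 Hinf.
assert (HM : 0 <= M).
{ apply Rle_trans with (2 := H0 1 Rlt_0_1), norm_ge_0. }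
assert (Hc : forall t, 0 < t ->
    continuous (fun t => scal (Rpower t (l - 1)) (f t)) t).
{ intros t Ht; apply (continuous_scal (V := V)); [|apply Hf, Ht].
  apply continuous_Rpower, Ht. }
assert (Hn : forall t, norm (scal (Rpower t (l - 1)) (f t)) <= Rpower t (l - 1) * norm (f t)).
{ intros t; apply Rle_trans with (1 := norm_scal (V := V) (Rpower t (l - 1) : R_AbsRing) (f t)).
  right; apply (f_equal (fun r => r * norm (f t))).
  apply Rabs_pos_eq, Rlt_le, exp_pos. }
assert (Hg : forall a t, 0 < t -> continuous (fun x => M * Rpower x (a - 1)) t).
{ intros a t Ht; apply (continuous_scal_r (V := R_NormedModule)), continuous_Rpower, Ht. }
apply (ex_RInt_gen_Chasles _ 1).
- apply (ex_RInt_gen_dominated V _ (fun t => M * Rpower t (l - 1))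
    (fun t => M * Rpower t l / l) (fun t => 0 < t <= 1) _ _ _ _
    (M * 0 / l) (M * Rpower 1 l / l)).
  + intros; lra.
  + intros t Ht; apply is_derive_Rpower; lra.
  + intros t Ht; apply Hg; lra.
  + intros t Ht; apply Hc; lra.
  + intros t Ht; apply Rle_trans with (1 := Hn t).
    rewrite Rmult_comm; apply Rmult_le_compat_r; [apply Rlt_le, exp_pos | apply H0; lra].
  + exists (mkposreal 1 Rlt_0_1); intros t Ht Ht0.
    apply Rabs_def2 in Ht; unfold minus, plus, opp in Ht; simpl in Ht; lra.
  + unfold at_point; lra.
  + apply filterlim_mult_div, Rpower_lim_0; [typeclasses eauto | lra].
  + intros P HP; exact (locally_singleton _ _ HP).
- apply (ex_RInt_gen_dominated V _ (fun t => M * Rpower t (l - 1 - 1))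
    (fun t => M * Rpower t (l - 1) / (l - 1)) (fun t => 1 <= t) _ _ _ _
    (M * Rpower 1 (l - 1) / (l - 1)) (M * 0 / (l - 1))).
  + intros; lra.
  + intros t Ht; apply is_derive_Rpower; lra.
  + intros t Ht; apply Hg; lra.
  + intros t Ht; apply Hc; lra.
  + intros t Ht; apply Rle_trans with (1 := Hn t).
    unfold Rminus at 2; rewrite Rpower_plus, Rpower_Ropp, Rpower_1 by lra.
    assert (Hp : 0 < Rpower t (l - 1)) by apply exp_pos.
    apply Rle_trans with (Rpower t (l - 1) * (/ t * M)); [|right; ring].
    apply Rmult_le_compat_l; [lra|].
    apply Rmult_le_reg_l with t; [lra|].
    rewrite <- Rmult_assoc, Rinv_r, Rmult_1_l by lra; apply Hinf; lra.
  + unfold at_point; lra.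
  + exists 1; intros t Ht; lra.
  + intros P HP; exact (locally_singleton _ _ HP).
  + apply filterlim_mult_div, Rpower_lim_infty; [typeclasses eauto | lra].
Qed.
(** * The real inner product *)

Local Notation rscal r x := (scal (RtoC r : C_AbsRing) x).

(* Vectors are typed through the normed module on which [bounded_op H] is built,
   so that sums of vectors and values of operators share one group structure. *)
Local Notation vec W :=
  (NormedModule.sort C_AbsRing (CompleteNormedModule.NormedModule C_AbsRing W)).

(** Every inequality below concerns real parts, and the real inner product is
    bilinear over [R] and symmetric; the complex structure is recovered from it
    by [Im_inner]. *)
Definition rip {H : Hilbert} (x y : vec H) : R := Re (inner x y).

Lemma rip_sym (H : Hilbert) (x y : vec H) : rip x y = rip y x.
Proof. unfold rip; rewrite (inner_conj x y); reflexivity. Qed.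

Lemma rip_plus_l (H : Hilbert) (x y z : vec H) : rip (plus x y) z = rip x z + rip y z.
Proof. exact (f_equal Re (inner_plus_l x y z)). Qed.

Lemma rip_plus_r (H : Hilbert) (x y z : vec H) : rip z (plus x y) = rip z x + rip z y.
Proof. rewrite !(rip_sym H z); apply rip_plus_l. Qed.

Lemma inner_scal_left (H : Hilbert) (k : C) (x y : vec H) :
  inner (scal (k : C_AbsRing) x) y = Cmult k (inner x y).
Proof. exact (inner_scal_l k x y). Qed.

Lemma inner_scal_r (H : Hilbert) (k : C) (x y : vec H) :
  inner x (scal (k : C_AbsRing) y) = Cmult (Cconj k) (inner x y).
Proof.
rewrite (inner_conj (scal (k : C_AbsRing) y : vec H) x), inner_scal_left, Cmult_conj,
  <- inner_conj.
reflexivity. Qed.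

Lemma rip_scal_conj (H : Hilbert) (k : C) (x y : vec H) :
  rip (scal (k : C_AbsRing) x) y = rip x (scal (Cconj k : C_AbsRing) y).
Proof. unfold rip; rewrite inner_scal_left, inner_scal_r, Cconj_conj; reflexivity. Qed.

Lemma rip_scal_l (H : Hilbert) (r : R) (x y : vec H) : rip (rscal r x) y = r * rip x y.
Proof. unfold rip; rewrite inner_scal_left; unfold Re, Cmult; simpl; ring. Qed.

Lemma rip_scal_r (H : Hilbert) (r : R) (x y : vec H) : rip x (rscal r y) = r * rip x y.
Proof. rewrite !(rip_sym H x); apply rip_scal_l. Qed.

Lemma Im_inner (H : Hilbert) (x y : vec H) : Im (inner x y) = rip x (scal (Ci : C_AbsRing) y).
Proof. unfold rip; rewrite inner_scal_r; unfold Re, Im, Cmult, Cconj, Ci; simpl; ring. Qed.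

Lemma rip_diag (H : Hilbert) (x : vec H) : rip x x = norm x ^ 2.
Proof. unfold rip; rewrite inner_norm; reflexivity. Qed.

Lemma rip_opp_l (H : Hilbert) (x y : vec H) : rip (opp x) y = - rip x y.
Proof.
assert (E0 : rip (zero : vec H) y = 0).
{ assert (E := rip_plus_l H zero zero y); rewrite plus_zero_l in E; lra. }
assert (E := rip_plus_l H x (opp x) y).
replace (plus x (opp x)) with (zero : vec H) in E by (symmetry; exact (plus_opp_r x)); lra.
Qed.

Lemma rip_opp_r (H : Hilbert) (x y : vec H) : rip x (opp y) = - rip x y.
Proof. rewrite !(rip_sym H x); apply rip_opp_l. Qed.

Lemma rip_minus_l (H : Hilbert) (x y z : vec H) : rip (minus x y) z = rip x z - rip y z.
Proof. unfold minus; rewrite rip_plus_l, rip_opp_l; ring. Qed.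

Lemma rip_minus_r (H : Hilbert) (x y z : vec H) : rip z (minus x y) = rip z x - rip z y.
Proof. unfold minus; rewrite rip_plus_r, rip_opp_r; ring. Qed.

Lemma rip_ext (H : Hilbert) (x y : vec H) : (forall z : vec H, rip z x = rip z y) -> x = y.
Proof.
intros Hxy; apply norm_minus_small; intros e.
assert (E : norm (minus x y) ^ 2 = 0).
{ rewrite <- rip_diag, rip_minus_r, Hxy; ring. }
apply Rle_trans with 0; [right | apply Rlt_le, cond_pos].
apply Rsqr_0_uniq; unfold Rsqr; rewrite <- E; ring.
Qed.

(** Common source of the Cauchy-Schwarz inequality, both for the inner
    product and for a positive operator, and of the variational step in the
    Riesz theorem. *)
Lemma quadratic_discriminant (a b c : R) :
  0 <= c -> (forall t, 0 <= a + 2 * t * b + t ^ 2 * c) -> b ^ 2 <= a * c.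
Proof.
intros Hc Hq; destruct (Req_dec c 0) as [->|Hc0].
- destruct (Req_dec b 0) as [->|Hb]; [lra|].
  specialize (Hq (- (a + 1) / (2 * b))).
  replace (a + 2 * (- (a + 1) / (2 * b)) * b + (- (a + 1) / (2 * b)) ^ 2 * 0)
    with (- 1) in Hq by (field; exact Hb); lra.
- specialize (Hq (- b / c)).
  replace (a + 2 * (- b / c) * b + (- b / c) ^ 2 * c) with ((a * c - b ^ 2) / c) in Hq
    by (field; exact Hc0).
  apply (Rmult_le_compat_r c) in Hq; [|exact Hc].
  unfold Rdiv in Hq; rewrite Rmult_assoc, Rinv_l in Hq by exact Hc0; lra.
Qed.

Lemma rip_le_norm (H : Hilbert) (x y : vec H) : Rabs (rip x y) <= norm x * norm y.
Proof.
assert (Hx := norm_ge_0 x); assert (Hy := norm_ge_0 y).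
assert (Hs : rip x y ^ 2 <= norm x ^ 2 * norm y ^ 2).
{ apply quadratic_discriminant; [nra|]; intros t.
  replace (norm x ^ 2 + 2 * t * rip x y + t ^ 2 * norm y ^ 2)
    with (norm (plus x (rscal t y)) ^ 2); [nra|].
  rewrite <- !rip_diag, rip_plus_l, !rip_plus_r, !rip_scal_l, !rip_scal_r, (rip_sym H y x).
  ring. }
assert (Hxy : 0 <= norm x * norm y) by (apply Rmult_le_pos; trivial).
rewrite <- (Rabs_pos_eq _ Hxy); apply Rsqr_le_abs_0; unfold Rsqr; lra.
Qed.

(** * Riesz representation and adjoints *)

(** Completeness in the form of Cantor's intersection theorem.  Approximate
    solutions of a problem form such a family [S e], so that no sequence of
    them has to be chosen. *)
Lemma shrinking_sets_limit (W : CompleteNormedModule C_AbsRing) (S : R -> vec W -> Prop) :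
  (forall e, 0 < e -> exists x, S e x) ->
  (forall d e x, d <= e -> S d x -> S e x) ->
  (forall e, 0 < e -> exists d, 0 < d /\
     forall x y, S d x -> S d y -> norm (minus y x) < e) ->
  exists l : vec W, forall e, 0 < e -> exists x, S e x /\ norm (minus x l) < e.
Proof.
intros Hne Hmon Hdiam.
pose (F := fun P : vec W -> Prop => exists d, 0 < d /\ forall x, S d x -> P x).
assert (PF : ProperFilter F).
{ split.
  - intros P [d [Hd HP]]; destruct (Hne d Hd) as [x Hx]; exists x; auto.
  - split.
    + exists 1; split; [lra|trivial].
    + intros P Q [d [Hd HP]] [e [He HQ]]; exists (Rmin d e); split.
      { apply Rmin_glb_lt; trivial. }
      intros x Hx; split; [apply HP | apply HQ]; apply (Hmon (Rmin d e)); trivial;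
        [apply Rmin_l | apply Rmin_r].
    + intros P Q HPQ [d [Hd HP]]; exists d; split; auto. }
assert (CF : cauchy F).
{ intros eps; destruct (Hdiam eps (cond_pos eps)) as [d [Hd Hdd]].
  destruct (Hne d Hd) as [x Hx]; exists x, d; split; trivial.
  intros y Hy; apply (norm_compat1 (V := W)), Hdd; trivial. }
exists (lim F); intros e He.
pose proof (norm_factor_gt_0 (V := W)) as Hnf.
assert (He' : 0 < e / @norm_factor _ W) by (apply Rdiv_lt_0_compat; trivial).
destruct (complete_cauchy F PF CF (mkposreal _ He')) as [d [Hd HP]].
destruct (Hne (Rmin d e)) as [x Hx]; [apply Rmin_glb_lt; trivial|].
exists x; split.
- apply (Hmon (Rmin d e)); [apply Rmin_r | trivial].
- assert (B := HP x (Hmon _ _ _ (Rmin_l d e) Hx)).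
  apply (norm_compat2 (V := W)) in B; simpl in B.
  replace e with (@norm_factor _ W * (e / @norm_factor _ W)) by (field; lra).
  exact B.
Qed.

(** The representing vector minimises [J x = norm x ^ 2 - 2 * f x].  By the
    parallelogram law, near-minimisers of [J] are close to each other, hence
    converge; and a near-minimiser [x] nearly satisfies [rip x h = f h], since
    [J] cannot decrease much along the line through [x] in direction [h]. *)
Lemma Riesz_representation (H : Hilbert) (f : vec H -> R) (M : R) :
  (forall x y : vec H, f (plus x y) = f x + f y) ->
  (forall r (x : vec H), f (rscal r x) = r * f x) ->
  (forall x : vec H, Rabs (f x) <= M * norm x) ->
  exists z : vec H, forall x : vec H, f x = rip x z.
Proof.
intros Hadd Hscal Hbd.
pose (J := fun x : vec H => norm x ^ 2 - 2 * f x).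
assert (HJlow : forall x, - M ^ 2 <= J x).
{ intros x; unfold J; generalize (Rabs_le_between (f x) (M * norm x)); intros [K _].
  specialize (K (Hbd x)); assert (0 <= (norm x - M) ^ 2) by apply pow2_ge_0; nra. }
destruct (completeness (fun r => exists x : vec H, r = - J x)) as [s [Hub Hlub]].
{ exists (M ^ 2); intros r [x ->]; specialize (HJlow x); lra. }
{ exists (- J zero), zero; reflexivity. }
assert (Hlow : forall x, - s <= J x).
{ intros x; assert (- J x <= s) by (apply Hub; exists x; reflexivity); lra. }
destruct (shrinking_sets_limit H (fun e x => J x <= - s + e)) as [l Hl].
- intros e He; apply NNPP; intros Hno.
  assert (s <= s - e); [|lra].
  apply Hlub; intros r [x ->].
  destruct (Rle_dec (- J x) (s - e)) as [?|Hn]; trivial.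
  exfalso; apply Hno; exists x; lra.
- intros d e x Hde Hx; lra.
- intros e He; exists (e ^ 2 / 8); split; [nra|]; intros x y Hx Hy.
  (* Parallelogram law; the midpoint has [J] at least [- s]. *)
  assert (E : norm (minus y x) ^ 2 =
      2 * J x + 2 * J y - 4 * J (rscal (1 / 2) (plus x y))).
  { unfold J; rewrite Hscal, Hadd, <- !rip_diag, rip_scal_l, rip_scal_r.
    rewrite rip_minus_l, !rip_minus_r, rip_plus_l, !rip_plus_r, (rip_sym H y x).
    field. }
  generalize (Hlow (rscal (1 / 2) (plus x y))) (norm_ge_0 (minus y x)); intros; nra.
- exists l; intros h.
  set (K := norm h ^ 2).
  assert (HK : 0 <= K) by apply pow2_ge_0.
  assert (Hall : forall e, 0 < e -> e <= 1 -> (f h - rip h l) ^ 2 <= 4 * e * K).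
  { intros e He He1; destruct (Hl e He) as [x [Hx Hxl]].
    (* Near-minimality of [x] along the line [x + t h]. *)
    assert (H1 : (rip x h - f h) ^ 2 <= e * K).
    { apply quadratic_discriminant; trivial; intros t.
      assert (H2 := Hlow (plus x (rscal t h))); unfold J in H2, Hx.
      rewrite Hadd, Hscal, <- rip_diag, rip_plus_l, !rip_plus_r, !rip_scal_l,
        !rip_scal_r, !rip_diag, (rip_sym H h x) in H2.
      fold K in H2; nra. }
    assert (H3 : (rip (minus x l) h) ^ 2 <= e * K).
    { assert (C := rip_le_norm H (minus x l) h).
      assert (C2 := norm_ge_0 (minus x l)); assert (C3 := norm_ge_0 h).
      apply Rle_trans with (norm (minus x l) ^ 2 * K).
      - unfold K; apply Rabs_le_between in C; nra.
      - apply Rmult_le_compat_r; [trivial | nra]. }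
    rewrite rip_minus_l in H3; rewrite (rip_sym H h l).
    generalize (pow2_ge_0 ((rip x h - f h) + (rip x h - rip l h))); nra. }
  destruct (Req_dec (f h - rip h l) 0) as [?|Hn]; [lra|exfalso].
  set (g := f h - rip h l) in *.
  assert (Hg : 0 < g ^ 2) by (apply pow2_gt_0; trivial).
  assert (Hd : 0 < g ^ 2 / (8 * (K + 1))) by (apply Rdiv_lt_0_compat; lra).
  (* For this [e] the bound [4 * e * K] is at most half of [g ^ 2]. *)
  pose (e := Rmin 1 (g ^ 2 / (8 * (K + 1)))).
  assert (He : 0 < e) by (apply Rmin_glb_lt; lra).
  specialize (Hall e He (Rmin_l _ _)).
  assert (He2 : e <= g ^ 2 / (8 * (K + 1))) by apply Rmin_r.
  apply (Rmult_le_compat_r (8 * (K + 1))) in He2; [|lra].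
  unfold Rdiv in He2; rewrite Rmult_assoc, Rinv_l, Rmult_1_r in He2 by lra.
  nra.
Qed.

(** Imaginary parts of inner products are real parts after multiplication by
    [Ci], with which [B] commutes. *)
Lemma is_adjoint_rip (H : Hilbert) (A B : bounded_op H) :
  (forall x y : vec H, rip (A x) y = rip x (B y)) -> is_adjoint A B.
Proof.
intros HAB x y; rewrite (surjective_pairing (inner (A x) y)),
  (surjective_pairing (inner x (B y))); f_equal; [apply HAB|].
change (Im (inner (A x) y) = Im (inner x (B y))).
rewrite !Im_inner, HAB, (linear_scal _ (bop_linear B)); reflexivity.
Qed.

Lemma adjoint_exists (H : Hilbert) (A : bounded_op H) : exists B, is_adjoint A B.
Proof.
assert (HR : forall y : vec H, exists z : vec H, forall x : vec H, rip (A x) y = rip x z).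
{ intros y; apply (Riesz_representation H (fun x => rip (A x) y) (opnorm A * norm y)).
  - intros x x'; rewrite (linear_plus _ (bop_linear A)); apply rip_plus_l.
  - intros r x; rewrite (linear_scal _ (bop_linear A)); apply rip_scal_l.
  - intros x; apply Rle_trans with (1 := rip_le_norm H (A x) y).
    assert (K := opnorm_bound A x); assert (0 <= norm y) by apply norm_ge_0.
    nra. }
pose (f := fun y : vec H => epsilon (inhabits (zero : vec H))
                    (fun z : vec H => forall x : vec H, rip (A x) y = rip x z)).
assert (Hf : forall y x : vec H, rip (A x) y = rip x (f y)).
{ intros y; exact (epsilon_spec _ _ (HR y)). }
assert (Lf : is_linear f).
{ split.
  - intros x y; apply rip_ext; intros z.
    rewrite rip_plus_r, <- !Hf; apply rip_plus_r.
  - intros k x; apply rip_ext; intros z.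
    rewrite <- (Cconj_conj k), <- Hf, <- !rip_scal_conj, <- Hf,
      (linear_scal _ (bop_linear A)); reflexivity.
  - exists (opnorm A + 1); split; [generalize (opnorm_ge0 A); lra|].
    intros y.
    assert (E : norm (f y) ^ 2 = rip (A (f y)) y) by (rewrite Hf; symmetry; apply rip_diag).
    assert (K := Rle_abs (rip (A (f y)) y)).
    assert (K2 := rip_le_norm H (A (f y)) y).
    assert (K3 := opnorm_bound A (f y)).
    assert (0 <= norm y) by apply norm_ge_0.
    assert (0 <= norm (f y)) by apply norm_ge_0.
    assert (0 <= opnorm A) by apply opnorm_ge0.
    destruct (Req_dec (norm (f y)) 0) as [->|Hn]; [nra|].
    apply Rmult_le_reg_l with (norm (f y)); nra. }
exists (Bop Lf); apply is_adjoint_rip; intros x y; exact (Hf y x).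
Qed.

Lemma adjoint_spec (H : Hilbert) (A : bounded_op H) (x y : vec H) :
  rip (A x) y = rip x (adjoint A y).
Proof.
unfold rip; f_equal.
exact (epsilon_spec (inhabits (bop_zero H)) _ (adjoint_exists H A) x y).
Qed.

Lemma selfadjoint_rip (H : Hilbert) (A : bounded_op H) :
  selfadjoint A <-> forall x y : vec H, rip (A x) y = rip x (A y).
Proof.
split.
- intros HA x y; rewrite adjoint_spec, HA; reflexivity.
- intros HA; apply bop_eq; intros y; apply rip_ext; intros x.
  rewrite <- adjoint_spec; apply HA.
Qed.

Lemma rip_bop_Re (H : Hilbert) (A : bounded_op H) (x y : vec H) :
  rip (bop_Re A x) y = (rip (A x) y + rip x (A y)) / 2.
Proof.
change (bop_Re A x) with (rscal (1 / 2) (plus (A x) (adjoint A x))).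
rewrite rip_scal_l, rip_plus_l, (rip_sym H (adjoint A x)), <- adjoint_spec, (rip_sym H x).
field.
Qed.

Lemma rip_bop_Re_diag (H : Hilbert) (A : bounded_op H) (x : vec H) :
  rip (bop_Re A x) x = rip (A x) x.
Proof. rewrite rip_bop_Re, (rip_sym H x); field. Qed.

Lemma bop_Re_selfadjoint (H : Hilbert) (A : bounded_op H) : selfadjoint (bop_Re A).
Proof.
apply selfadjoint_rip; intros x y.
rewrite (rip_sym H x), !rip_bop_Re, (rip_sym H (A y)), (rip_sym H y); field.
Qed.

(** * Coercive operators *)

Definition coercive {H : Hilbert} (T : bounded_op H) (c : R) : Prop :=
  0 < c /\ forall x : vec H, c * norm x ^ 2 <= rip (T x) x.

Lemma coercive_lower_bound (H : Hilbert) (T : bounded_op H) (c : R) (x : vec H) :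
  coercive T c -> c * norm x <= norm (T x).
Proof.
intros [Hc HT]; assert (0 <= norm x) by apply norm_ge_0.
destruct (Req_dec (norm x) 0) as [E|Hn].
- rewrite E, Rmult_0_r; apply norm_ge_0.
- apply Rmult_le_reg_r with (norm x); [lra|].
  generalize (HT x) (Rle_abs (rip (T x) x)) (rip_le_norm H (T x) x); lra.
Qed.

(** Richardson iteration: replacing [x] by [x + r (y - T x)] multiplies the
    residual [y - T x] by [1 - r T], a contraction for [r = c / M ^ 2].  Thus
    residuals become arbitrarily small, and the lower bound on [T] turns small
    residuals into convergence. *)
Lemma coercive_surjective (H : Hilbert) (T : bounded_op H) (c : R) (y : vec H) :
  coercive T c -> exists x : vec H, T x = y.
Proof.
intros HTc; assert (Hlb := fun x => coercive_lower_bound H T c x HTc).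
destruct HTc as [Hc HT].
(* The summand [c] gives [c <= M] and [0 < M], so that the contraction factor
   [k] lies in [0, 1). *)
pose (M := opnorm T + c).
assert (HM : forall x : vec H, norm (T x) <= M * norm x).
{ intros x; generalize (opnorm_bound T x) (norm_ge_0 x); unfold M; nra. }
assert (HcM : 0 < c <= M) by (generalize (opnorm_ge0 T); unfold M; lra).
pose (k := 1 - (c / M) ^ 2).
assert (HdM : 0 < c / M <= 1).
{ split; [apply Rdiv_lt_0_compat; lra|].
  apply Rmult_le_reg_r with M; [lra|].
  unfold Rdiv; rewrite Rmult_assoc, Rinv_l; lra. }
assert (Hk : 0 <= k < 1) by (unfold k; nra).
assert (Hstep : forall v : vec H,
    norm (minus v (T (rscal (c / M ^ 2) v))) ^ 2 <= k * norm v ^ 2).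
{ intros v; rewrite (linear_scal _ (bop_linear T)).
  rewrite <- rip_diag, rip_minus_l, !rip_minus_r, !rip_scal_l, !rip_scal_r, !rip_diag.
  rewrite (rip_sym H v (T v)).
  assert (H1 := HT v); assert (H2 := HM v); assert (H3 := norm_ge_0 (T v)).
  assert (H4 := norm_ge_0 v).
  assert (H5 : norm (T v) ^ 2 <= M ^ 2 * norm v ^ 2) by nra.
  assert (Hr : 0 < c / M ^ 2) by (apply Rdiv_lt_0_compat; nra).
  assert (E1 : c / M ^ 2 * (c / M ^ 2 * (M ^ 2 * norm v ^ 2)) = (c / M) ^ 2 * norm v ^ 2)
    by (field; lra).
  assert (E2 : c / M ^ 2 * (c * norm v ^ 2) = (c / M) ^ 2 * norm v ^ 2) by (field; lra).
  apply (Rmult_le_compat_l (c / M ^ 2)) in H1; [|lra].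
  apply (Rmult_le_compat_l (c / M ^ 2)) in H5; [|lra].
  apply (Rmult_le_compat_l (c / M ^ 2)) in H5; [|lra].
  unfold k; lra. }
assert (Happrox : forall n, exists x : vec H, norm (minus y (T x)) ^ 2 <= k ^ n * norm y ^ 2).
{ induction n as [|n [x IH]].
  - exists (zero : vec H).
    assert (E : minus y (T zero) = y).
    { transitivity (minus y (zero : vec H)); [|exact (minus_zero_r y)].
      f_equal; apply (linear_zero _ (bop_linear T)). }
    rewrite E; simpl; lra.
  - exists (plus x (rscal (c / M ^ 2) (minus y (T x)))).
    rewrite (linear_plus _ (bop_linear T)).
    assert (E : minus y (plus (T x) (T (rscal (c / M ^ 2) (minus y (T x))))) =
       minus (minus y (T x)) (T (rscal (c / M ^ 2) (minus y (T x))))).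
    { apply rip_ext; intros z; rewrite !rip_minus_r, rip_plus_r; ring. }
    rewrite E; apply Rle_trans with (1 := Hstep _); simpl pow at 2.
    rewrite Rmult_assoc; apply Rmult_le_compat_l; [lra | exact IH]. }
destruct (shrinking_sets_limit H (fun e x => norm (minus y (T x)) <= e)) as [l Hl].
- intros e He.
  assert (Hy : 0 <= norm y ^ 2) by apply pow2_ge_0.
  destruct (pow_lt_1_zero k) with (y := e ^ 2 / (norm y ^ 2 + 1)) as [n Hn].
  { rewrite Rabs_pos_eq; lra. }
  { apply Rdiv_lt_0_compat; nra. }
  specialize (Hn n (Nat.le_refl n)); rewrite Rabs_pos_eq in Hn by (apply pow_le; lra).
  destruct (Happrox n) as [x Hx]; exists x.
  apply (Rmult_lt_compat_r (norm y ^ 2 + 1)) in Hn; [|lra].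
  replace (e ^ 2 / (norm y ^ 2 + 1) * (norm y ^ 2 + 1)) with (e ^ 2) in Hn by (field; lra).
  assert (0 <= k ^ n) by (apply pow_le; lra).
  assert (H2 := norm_ge_0 (minus y (T x))); nra.
- intros d e x; lra.
- intros e He; exists (c * e / 3); split; [nra|]; intros x x' Hx Hx'.
  assert (K := Hlb (minus x' x)); rewrite (linear_minus _ _ _ (bop_linear T)) in K.
  assert (K2 := norm_minus_triangle (T x') y (T x)).
  rewrite (norm_minus_sym (T x') y) in K2; nra.
- exists l; symmetry; apply norm_minus_small; intros e.
  assert (He := cond_pos e).
  destruct (Hl (e / (1 + M))) as [x [Hx Hxl]]; [apply Rdiv_lt_0_compat; lra|].
  assert (K := HM (minus x l)); rewrite (linear_minus _ _ _ (bop_linear T)) in K.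
  assert (K2 := norm_minus_triangle y (T x) (T l)).
  replace (pos e) with (e / (1 + M) + M * (e / (1 + M))) by (field; lra).
  assert (M * norm (minus x l) <= M * (e / (1 + M))) by (apply Rmult_le_compat_l; lra).
  lra.
Qed.

Lemma bop_inv_r (H : Hilbert) (T : bounded_op H) (x : vec H) :
  invertible_op T -> T (bop_inv T x) = x.
Proof.
intros HT; destruct (epsilon_spec (inhabits (bop_zero H)) _ HT) as [E _].
exact (f_equal (fun S : bounded_op H => S x) E).
Qed.

Lemma bop_inv_l (H : Hilbert) (T : bounded_op H) (x : vec H) :
  invertible_op T -> bop_inv T (T x) = x.
Proof.
intros HT; destruct (epsilon_spec (inhabits (bop_zero H)) _ HT) as [_ E].
exact (f_equal (fun S : bounded_op H => S x) E).
Qed.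

(** The Lax-Milgram theorem: the lower bound on [T] makes the inverse of the
    surjection unique and bounded. *)
Lemma coercive_invertible (H : Hilbert) (T : bounded_op H) (c : R) :
  coercive T c -> invertible_op T.
Proof.
intros HT; assert (Hlb := fun x => coercive_lower_bound H T c x HT).
assert (Hc : 0 < c) by apply HT.
assert (Hinj : forall x y : vec H, T x = T y -> x = y).
{ intros x y Hxy; apply norm_minus_small; intros e.
  assert (K := Hlb (minus x y)).
  rewrite (linear_minus _ _ _ (bop_linear T)), Hxy in K.
  assert (E0 : norm (minus (T y) (T y)) = 0).
  { transitivity (norm (zero : vec H));
      [exact (f_equal norm (minus_eq_zero (T y))) | exact norm_zero]. }
  rewrite E0 in K.
  generalize (cond_pos e); nra. }
pose (f := fun y : vec H => epsilon (inhabits (zero : vec H)) (fun x : vec H => T x = y)).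
assert (Hf : forall y : vec H, T (f y) = y).
{ intros y; exact (epsilon_spec _ _ (coercive_surjective H T c y HT)). }
assert (Lf : is_linear f).
{ split.
  - intros x y; apply Hinj; rewrite (linear_plus _ (bop_linear T)), !Hf; reflexivity.
  - intros k x; apply Hinj; rewrite (linear_scal _ (bop_linear T)), !Hf; reflexivity.
  - exists (/ c); split; [apply Rinv_0_lt_compat, Hc|].
    intros y; apply Rmult_le_reg_l with c; [exact Hc|].
    rewrite <- Rmult_assoc, Rinv_r, Rmult_1_l by lra.
    apply Rle_trans with (1 := Hlb (f y)); rewrite Hf; lra. }
exists (Bop Lf); split; apply bop_eq; intros x; [apply Hf | apply Hinj, Hf].
Qed.

(** Cauchy-Schwarz for the form [<P x, y>], applied at [y = P^-1 x], gives
    [norm x ^ 4 <= <P x, x> <x, P^-1 x>]: boundedness of the inverse becomes a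
    lower bound for the form, without square roots of operators. *)
Lemma strictly_positive_coercive (H : Hilbert) (P : bounded_op H) :
  strictly_positive_op P -> exists c, coercive P c.
Proof.
intros [[Hs Hp] Hi]; rewrite selfadjoint_rip in Hs.
change (forall x : vec H, 0 <= rip (P x) x) in Hp.
assert (CS : forall x y : vec H, rip (P x) y ^ 2 <= rip (P x) x * rip (P y) y).
{ intros x y; apply quadratic_discriminant; [apply Hp|]; intros t.
  apply Rle_trans with (1 := Hp (plus x (rscal t y))); right.
  rewrite (linear_plus _ (bop_linear P)), (linear_scal _ (bop_linear P)).
  rewrite rip_plus_l, !rip_plus_r, !rip_scal_l, !rip_scal_r.
  rewrite (Hs y x), (rip_sym H y (P x)); ring. }
(* The summand 1 keeps [N] positive on the zero space. *)
set (N := opnorm (bop_inv P) + 1).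
assert (HN : 0 < N) by (generalize (opnorm_ge0 (bop_inv P)); unfold N; lra).
exists (/ N); split; [apply Rinv_0_lt_compat, HN|]; intros x.
specialize (CS x (bop_inv P x)).
rewrite Hs, bop_inv_r, rip_diag in CS by exact Hi.
assert (K1 := rip_le_norm H x (bop_inv P x)).
assert (K2 := opnorm_bound (bop_inv P) x).
assert (K3 := Rle_abs (rip x (bop_inv P x))).
assert (Hx := norm_ge_0 x); assert (Hpx := Hp x).
assert (K4 : rip x (bop_inv P x) <= N * norm x ^ 2) by (unfold N; nra).
assert (K5 : norm x ^ 2 * norm x ^ 2 <= norm x ^ 2 * (N * rip (P x) x)) by nra.
apply Rmult_le_reg_l with N; [exact HN|].
rewrite <- Rmult_assoc, Rinv_r, Rmult_1_l by lra.
destruct (Req_dec (norm x) 0) as [E|E]; [rewrite E; nra|].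
apply Rmult_le_reg_l with (norm x ^ 2); [apply pow2_gt_0|]; trivial.
Qed.

Lemma accretive_coercive (H : Hilbert) (A : bounded_op H) :
  accretive A -> exists c, coercive (bop_Re A) c /\ coercive A c.
Proof.
intros HA; destruct (strictly_positive_coercive H _ HA) as [c [Hc Hco]].
exists c; repeat split; trivial.
intros x; rewrite <- rip_bop_Re_diag; apply Hco.
Qed.

(** [<T^-1 x, x>] is the form of [T] at [T^-1 x], whose norm is at least
    [norm x] divided by the norm of [T]. *)
Lemma coercive_inv (H : Hilbert) (T : bounded_op H) (c : R) :
  coercive T c -> exists d, coercive (bop_inv T) d.
Proof.
intros HT; assert (Hi := coercive_invertible H T c HT); destruct HT as [Hc HT].
set (N := opnorm T + 1).
assert (HN : 0 < N) by (generalize (opnorm_ge0 T); unfold N; lra).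
assert (Hd : 0 < c / N ^ 2) by (apply Rdiv_lt_0_compat; nra).
exists (c / N ^ 2); split; [exact Hd|]; intros x.
assert (K := HT (bop_inv T x)); assert (K2 := opnorm_bound T (bop_inv T x)).
rewrite bop_inv_r in K, K2 by exact Hi; rewrite rip_sym.
apply Rle_trans with (2 := K).
assert (H1 := norm_ge_0 (bop_inv T x)); assert (H2 := norm_ge_0 x).
assert (K3 : norm x ^ 2 <= N ^ 2 * norm (bop_inv T x) ^ 2).
{ assert (norm x <= N * norm (bop_inv T x)) by (unfold N; lra); nra. }
apply (Rmult_le_compat_l (c / N ^ 2)) in K3; [|lra].
apply Rle_trans with (1 := K3); right; field; lra.
Qed.

(** * Operator pencils and the weighted geometric mean *)

Definition pencil {H : Hilbert} (A B : bounded_op H) (t : R) : bounded_op H :=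
  plus (bop_inv A) (scal t (bop_inv B)).

Lemma rip_pencil (H : Hilbert) (A B : bounded_op H) (t : R) (x y : vec H) :
  rip (pencil A B t x) y = rip (bop_inv A x) y + t * rip (bop_inv B x) y.
Proof.
change (pencil A B t x) with (plus (bop_inv A x) (rscal t (bop_inv B x))).
rewrite rip_plus_l, rip_scal_l; reflexivity.
Qed.

Lemma coercive_le (H : Hilbert) (T : bounded_op H) (c d : R) :
  0 < d -> d <= c -> coercive T c -> coercive T d.
Proof.
intros Hd Hdc [Hc HT]; split; [exact Hd|]; intros x.
generalize (HT x) (pow2_ge_0 (norm x)); nra.
Qed.

(** The factor [1 + t] gives at once the boundedness of the inverse near 0 and
    its decay at infinity. *)
Lemma pencil_coercive (H : Hilbert) (A B : bounded_op H) (a b : R) :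
  coercive A a -> coercive B b ->
  exists d, 0 < d /\ forall t, 0 < t -> coercive (pencil A B t) (d * (1 + t)).
Proof.
intros HA HB.
destruct (coercive_inv H A a HA) as [a' [Ha' HA']].
destruct (coercive_inv H B b HB) as [b' [Hb' HB']].
exists (Rmin a' b'); split; [apply Rmin_glb_lt; trivial|].
intros t Ht; split.
- apply Rmult_lt_0_compat; [apply Rmin_glb_lt; trivial | lra].
- intros x; rewrite rip_pencil.
  specialize (HA' x); specialize (HB' x).
  assert (Hx := pow2_ge_0 (norm x)).
  assert (K1 : Rmin a' b' * norm x ^ 2 <= rip (bop_inv A x) x).
  { apply Rle_trans with (2 := HA'), Rmult_le_compat_r; [exact Hx | apply Rmin_l]. }
  assert (K2 : Rmin a' b' * norm x ^ 2 <= rip (bop_inv B x) x).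
  { apply Rle_trans with (2 := HB'), Rmult_le_compat_r; [exact Hx | apply Rmin_r]. }
  apply (Rmult_le_compat_l t) in K2; lra.
Qed.

Lemma coercive_inv_bound (H : Hilbert) (T : bounded_op H) (c : R) (x : vec H) :
  coercive T c -> c * norm (bop_inv T x) <= norm x.
Proof.
intros HT; assert (K := coercive_lower_bound H T c (bop_inv T x) HT).
rewrite bop_inv_r in K by (apply (coercive_invertible H T c), HT); exact K.
Qed.

Lemma opnorm_coercive_inv (H : Hilbert) (T : bounded_op H) (c : R) :
  coercive T c -> c * opnorm (bop_inv T) <= 1.
Proof.
intros HT; assert (Hc : 0 < c) by apply HT.
apply Rmult_le_reg_l with (/ c); [apply Rinv_0_lt_compat, Hc|].
rewrite <- Rmult_assoc, Rinv_l, Rmult_1_l, Rmult_1_r by lra.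
apply opnorm_le; [apply Rlt_le, Rinv_0_lt_compat, Hc|]; intros x.
apply Rmult_le_reg_l with c; [exact Hc|].
rewrite <- Rmult_assoc, Rinv_r, Rmult_1_l by lra; apply coercive_inv_bound, HT.
Qed.

(** The resolvent identity, applied to vectors: for the two inverses [u], [v]
    of [x], the pencil at [s] sends [u - v] to [(t - s) B^-1 v]. *)
Lemma pencil_inv_lipschitz (H : Hilbert) (A B : bounded_op H) (d s t : R) :
  0 < s -> 0 < t ->
  coercive (pencil A B s) d -> coercive (pencil A B t) d ->
  opnorm (minus (bop_inv (pencil A B s)) (bop_inv (pencil A B t)))
    <= opnorm (bop_inv B) / d ^ 2 * Rabs (s - t).
Proof.
intros Hs Ht Cs Ct; assert (Hd : 0 < d) by apply Cs.
assert (Hd2 : 0 < d ^ 2) by nra.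
assert (HB := opnorm_ge0 (bop_inv B)); assert (Hst := Rabs_pos (s - t)).
apply opnorm_le.
{ apply Rmult_le_pos; [|exact Hst].
  apply Rmult_le_pos; [exact HB | apply Rlt_le, Rinv_0_lt_compat, Hd2]. }
intros x.
set (u := bop_inv (pencil A B s) x); set (v := bop_inv (pencil A B t) x).
change (norm (minus u v) <= opnorm (bop_inv B) / d ^ 2 * Rabs (s - t) * norm x).
assert (E : pencil A B s (minus u v) = rscal (t - s) (bop_inv B v)).
{ apply rip_ext; intros z; rewrite (rip_sym H z), (rip_sym H z).
  rewrite (linear_minus _ _ _ (bop_linear (pencil A B s))), rip_minus_l.
  unfold u at 1; rewrite bop_inv_r by (apply (coercive_invertible H _ d), Cs).
  assert (Ev : pencil A B t v = x) by (apply bop_inv_r, (coercive_invertible H _ d), Ct).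
  rewrite <- Ev, !rip_pencil, rip_scal_l; ring. }
assert (K1 := coercive_lower_bound H _ d (minus u v) Cs); rewrite E in K1.
assert (K2 := norm_scal_RtoC (t - s) (bop_inv B v)).
assert (K3 := opnorm_bound (bop_inv B) v).
assert (K4 : d * norm v <= norm x) by (apply coercive_inv_bound, Ct).
rewrite Rabs_minus_sym in K2.
apply Rmult_le_reg_l with (d ^ 2); [exact Hd2|].
replace (d ^ 2 * (opnorm (bop_inv B) / d ^ 2 * Rabs (s - t) * norm x))
  with (Rabs (s - t) * (opnorm (bop_inv B) * norm x)) by (field; lra).
apply Rle_trans with (d * (Rabs (s - t) * (opnorm (bop_inv B) * norm v))).
- replace (d ^ 2 * norm (minus u v)) with (d * (d * norm (minus u v))) by ring.
  apply Rmult_le_compat_l; [lra|].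
  apply Rle_trans with (1 := K1), Rle_trans with (1 := K2).
  apply Rmult_le_compat_l; trivial.
- replace (d * (Rabs (s - t) * (opnorm (bop_inv B) * norm v)))
    with (Rabs (s - t) * (opnorm (bop_inv B) * (d * norm v))) by ring.
  apply Rmult_le_compat_l; [trivial|]; apply Rmult_le_compat_l; trivial.
Qed.

Lemma pencil_inv_continuous (H : Hilbert) (A B : bounded_op H) (a b t : R) :
  coercive A a -> coercive B b -> 0 < t ->
  continuous (fun s => bop_inv (pencil A B s)) t.
Proof.
intros HA HB Ht; destruct (pencil_coercive H A B a b HA HB) as [d [Hd Hp]].
assert (Hp' : forall s, 0 < s -> coercive (pencil A B s) d).
{ intros s Hs; apply coercive_le with (d * (1 + s)); [trivial | nra | apply Hp, Hs]. }
set (L := opnorm (bop_inv B) / d ^ 2 + 1).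
assert (HL : 0 < L).
{ assert (0 <= opnorm (bop_inv B) / d ^ 2); [|unfold L; lra].
  apply Rmult_le_pos; [apply opnorm_ge0 | apply Rlt_le, Rinv_0_lt_compat; nra]. }
apply filterlim_locally; intros eps.
assert (He : 0 < Rmin t (eps / L)).
{ apply Rmin_glb_lt; [exact Ht | apply Rdiv_lt_0_compat; [apply cond_pos | exact HL]]. }
exists (mkposreal _ He); intros s Hst.
change (Rabs (s - t) < Rmin t (eps / L)) in Hst.
assert (H1 := Rmin_l t (eps / L)); assert (H2 := Rmin_r t (eps / L)).
assert (Hs : 0 < s) by (apply Rabs_def2 in Hst; lra).
change (opnorm (minus (bop_inv (pencil A B s)) (bop_inv (pencil A B t))) < eps).
apply Rle_lt_trans with
  (1 := pencil_inv_lipschitz H A B d s t Hs Ht (Hp' s Hs) (Hp' t Ht)).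
apply Rle_lt_trans with (L * Rabs (s - t)).
{ apply Rmult_le_compat_r; [apply Rabs_pos | unfold L; lra]. }
replace (pos eps) with (L * (eps / L)) by (field; lra).
apply Rmult_lt_compat_l; lra.
Qed.

Definition gmean_integrand {H : Hilbert} (l : R) (A B : bounded_op H) (t : R) :
    bounded_op H :=
  scal (Rpower t (l - 1)) (bop_inv (pencil A B t)).

Lemma gmean_converges (H : Hilbert) (A B : bounded_op H) (a b l : R) :
  coercive A a -> coercive B b -> 0 < l < 1 ->
  is_RInt_gen (gmean_integrand l A B) (at_right 0) (Rbar_locally p_infty)
    (RInt_gen (gmean_integrand l A B) (at_right 0) (Rbar_locally p_infty)).
Proof.
intros HA HB Hl.
apply (RInt_gen_correct (V := bop_CompleteNormedModule H) (gmean_integrand l A B)).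
destruct (pencil_coercive H A B a b HA HB) as [d [Hd Hp]].
assert (Hn : forall t, 0 < t -> (1 + t) * opnorm (bop_inv (pencil A B t)) <= / d).
{ intros t Ht; assert (K := opnorm_coercive_inv H _ _ (Hp t Ht)).
  apply Rmult_le_reg_l with d; [exact Hd|]; rewrite Rinv_r; lra. }
apply (ex_RInt_gen_power_weight (bop_CompleteNormedModule H)
  (fun t => bop_inv (pencil A B t)) l (/ d) Hl).
- intros t Ht; exact (pencil_inv_continuous H A B a b t HA HB Ht).
- intros t Ht; change (opnorm (bop_inv (pencil A B t)) <= / d).
  generalize (Hn t Ht) (opnorm_ge0 (bop_inv (pencil A B t))); nra.
- intros t Ht; change (t * opnorm (bop_inv (pencil A B t)) <= / d).
  generalize (Hn t Ht) (opnorm_ge0 (bop_inv (pencil A B t))); nra.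
Qed.

Lemma form_linear (H : Hilbert) (x y : vec H) :
  is_linear (fun T : bounded_op H => rip (T x) y : R).
Proof.
split.
- intros S T; exact (rip_plus_l H (S x) (T x) y).
- intros k T; exact (rip_scal_l H k (T x) y).
- exists (norm x * norm y + 1).
  assert (Hx := norm_ge_0 x); assert (Hy := norm_ge_0 y).
  assert (Hxy := Rmult_le_pos _ _ Hx Hy).
  split; [lra|]; intros T.
  change (Rabs (rip (T x) y) <= (norm x * norm y + 1) * opnorm T).
  apply Rle_trans with (1 := rip_le_norm H (T x) y).
  apply Rle_trans with (opnorm T * norm x * norm y).
  + apply Rmult_le_compat_r; [exact Hy | apply opnorm_bound].
  + generalize (opnorm_ge0 T); nra.
Qed.

Lemma is_RInt_gen_halfline_ge0 (f : R -> R) (I : R) :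
  (forall t, 0 < t -> 0 <= f t) ->
  is_RInt_gen f (at_right 0) (Rbar_locally p_infty) I -> 0 <= I.
Proof.
intros Hf; apply is_RInt_gen_ge0; try typeclasses eauto;
  apply Filter_prod with (fun a => 0 < a <= 1) (fun b => 1 <= b);
  try (exists 1; intros; lra);
  try (exists (mkposreal 1 Rlt_0_1); intros t Ht Ht0;
    change (Rabs (t - 0) < 1) in Ht; apply Rabs_def2 in Ht; lra).
- simpl; intros; lra.
- simpl; intros a b Ha Hb t Ht; apply Hf; lra.
Qed.

Lemma sin_weight_ge0 (l : R) : 0 < l < 1 -> 0 <= sin (l * PI) / PI.
Proof.
intros Hl; assert (HPI := PI_RGT_0).
apply Rmult_le_pos; [apply sin_ge_0; nra | apply Rlt_le, Rinv_0_lt_compat, HPI].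
Qed.

(** Monotonicity of the integral, for off-diagonal forms as well: with equal
    operators and swapped vectors it also yields the self-adjointness of means
    of self-adjoint operators. *)
Lemma gmean_form_le (H : Hilbert) (A B A' B' : bounded_op H) (a b a' b' l : R)
    (x y x' y' : vec H) :
  coercive A a -> coercive B b -> coercive A' a' -> coercive B' b' -> 0 < l < 1 ->
  (forall t, 0 < t ->
    rip (bop_inv (pencil A B t) x) y <= rip (bop_inv (pencil A' B' t) x') y') ->
  rip (gmean l A B x) y <= rip (gmean l A' B' x') y'.
Proof.
intros HA HB HA' HB' Hl Hle.
assert (I1 := gmean_converges H A B a b l HA HB Hl).
assert (I2 := gmean_converges H A' B' a' b' l HA' HB' Hl).
set (X := RInt_gen (gmean_integrand l A B) _ _) in I1.
set (Y := RInt_gen (gmean_integrand l A' B') _ _) in I2.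
change (gmean l A B x) with (rscal (sin (l * PI) / PI) (X x)).
change (gmean l A' B' x') with (rscal (sin (l * PI) / PI) (Y x')).
rewrite !rip_scal_l; apply Rmult_le_compat_l; [apply sin_weight_ge0, Hl|].
apply (is_RInt_gen_linear _ _ _ _ _ _ _ _ _ (form_linear H x y)) in I1.
apply (is_RInt_gen_linear _ _ _ _ _ _ _ _ _ (form_linear H x' y')) in I2.
apply Rminus_le_0.
refine (is_RInt_gen_halfline_ge0 _ _ _ (is_RInt_gen_minus _ _ _ _ I2 I1)).
intros t Ht.
change (0 <= rip (rscal (Rpower t (l - 1)) (bop_inv (pencil A' B' t) x')) y'
           - rip (rscal (Rpower t (l - 1)) (bop_inv (pencil A B t) x)) y).
rewrite !rip_scal_l.
assert (Hp : 0 < Rpower t (l - 1)) by apply exp_pos.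
specialize (Hle t Ht); nra.
Qed.

Lemma inv_selfadjoint (H : Hilbert) (T : bounded_op H) (c : R) (x y : vec H) :
  coercive T c -> (forall u v : vec H, rip (T u) v = rip u (T v)) ->
  rip (bop_inv T x) y = rip x (bop_inv T y).
Proof.
intros HT Hs; assert (Hi := coercive_invertible H T c HT).
rewrite <- (bop_inv_r H T x Hi) at 2; rewrite Hs, bop_inv_r by exact Hi; reflexivity.
Qed.

Lemma pencil_inv_selfadjoint (H : Hilbert) (P Q : bounded_op H) (p q t : R) (x y : vec H) :
  coercive P p -> coercive Q q -> selfadjoint P -> selfadjoint Q -> 0 < t ->
  rip (bop_inv (pencil P Q t) x) y = rip (bop_inv (pencil P Q t) y) x.
Proof.
intros HP HQ SP SQ Ht; rewrite selfadjoint_rip in SP, SQ.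
destruct (pencil_coercive H P Q p q HP HQ) as [d [Hd Hp]].
rewrite (rip_sym H _ x).
apply inv_selfadjoint with (d * (1 + t)); [apply Hp, Ht|]; intros u v.
rewrite (rip_sym H u), !rip_pencil.
rewrite (inv_selfadjoint H P p u v HP SP), (inv_selfadjoint H Q q u v HQ SQ).
rewrite !(rip_sym H u); reflexivity.
Qed.

Lemma gmean_selfadjoint (H : Hilbert) (P Q : bounded_op H) (p q l : R) :
  coercive P p -> coercive Q q -> selfadjoint P -> selfadjoint Q -> 0 < l < 1 ->
  selfadjoint (gmean l P Q).
Proof.
intros HP HQ SP SQ Hl; apply selfadjoint_rip.
assert (K : forall x y : vec H, rip (gmean l P Q x) y <= rip (gmean l P Q y) x).
{ intros x y; apply (gmean_form_le H P Q P Q p q p q); trivial.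
  intros t Ht; right; apply (pencil_inv_selfadjoint H P Q p q); trivial. }
intros x y; rewrite (rip_sym H x); apply Rle_antisym; apply K.
Qed.

(** Minimum property of the parallel sum.  With [u] the value of the inverse at
    [y + z], the minimising decomposition is [y0 = P^-1 u], [t z0 = t Q^-1 u];
    expanding the nonnegative forms of [P] at [y - y0] and of [Q] at
    [z - t z0], the latter with weight [1 / t], the cross terms add up to
    [- 2 <u, y + z>]. *)
Lemma parallel_sum_le (H : Hilbert) (P Q : bounded_op H) (p q t : R) (y z : vec H) :
  coercive P p -> coercive Q q -> selfadjoint P -> selfadjoint Q -> 0 < t ->
  rip (bop_inv (pencil P Q t) (plus y z)) (plus y z) <=
    rip (P y) y + rip (Q z) z / t.
Proof.
intros HP HQ SP SQ Ht; rewrite selfadjoint_rip in SP, SQ.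
destruct (pencil_coercive H P Q p q HP HQ) as [d [Hd Hp]].
set (u := bop_inv (pencil P Q t) (plus y z)).
assert (Eu : pencil P Q t u = plus y z)
  by (apply bop_inv_r, (coercive_invertible H _ (d * (1 + t))), Hp, Ht).
set (y0 := bop_inv P u); set (z0 := bop_inv Q u).
assert (EP : P y0 = u) by (apply bop_inv_r, (coercive_invertible H _ p), HP).
assert (EQ : Q z0 = u) by (apply bop_inv_r, (coercive_invertible H _ q), HQ).
assert (Ey : rip (plus y z) u = rip u y0 + t * rip u z0).
{ rewrite <- Eu, rip_pencil; fold y0 z0; rewrite (rip_sym H y0), (rip_sym H z0); ring. }
assert (Pos : forall (T : bounded_op H) c (v : vec H), coercive T c -> 0 <= rip (T v) v).
{ intros T c v [Hc HT]; generalize (HT v) (pow2_ge_0 (norm v)); nra. }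
assert (KP := Pos P p (minus y y0) HP).
rewrite (linear_minus _ _ _ (bop_linear P)), rip_minus_l, !rip_minus_r, EP,
  (SP y y0), EP, (rip_sym H y u) in KP.
assert (KQ := Pos Q q (minus z (rscal t z0)) HQ).
rewrite (linear_minus _ _ _ (bop_linear Q)), (linear_scal _ (bop_linear Q)),
  rip_minus_l, !rip_minus_r, !rip_scal_l, !rip_scal_r, EQ, (SQ z z0), EQ,
  (rip_sym H z u) in KQ.
rewrite rip_plus_l, (rip_sym H y u), (rip_sym H z u) in Ey.
rewrite rip_plus_r.
apply Rmult_le_reg_l with t; [exact Ht|].
replace (t * (rip (P y) y + rip (Q z) z / t)) with (t * rip (P y) y + rip (Q z) z)
  by (field; lra).
apply (Rmult_le_compat_l t) in KP; [|lra].
apply (f_equal (Rmult t)) in Ey; lra.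
Qed.

(** The accretive pencil itself splits [x] as [A^-1 w + t B^-1 w], and the
    value of this decomposition is exactly [Re <w, x>]. *)
Lemma accretive_pencil_inv_ge (H : Hilbert) (A B : bounded_op H) (a b t : R) (x : vec H) :
  coercive A a -> coercive B b -> coercive (bop_Re A) a -> coercive (bop_Re B) b ->
  0 < t ->
  rip (bop_inv (pencil (bop_Re A) (bop_Re B) t) x) x <= rip (bop_inv (pencil A B t) x) x.
Proof.
intros HA HB HRA HRB Ht.
destruct (pencil_coercive H A B a b HA HB) as [d [Hd Hp]].
set (w := bop_inv (pencil A B t) x).
set (y := bop_inv A w); set (z := rscal t (bop_inv B w)).
assert (Ex : x = plus y z).
{ symmetry; apply (bop_inv_r H (pencil A B t) x).
  apply (coercive_invertible H _ (d * (1 + t))), Hp, Ht. }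
assert (EA : A y = w) by (apply bop_inv_r, (coercive_invertible H _ a), HA).
assert (EB : B z = rscal t w).
{ unfold z; rewrite (linear_scal _ (bop_linear B)); f_equal.
  apply bop_inv_r, (coercive_invertible H _ b), HB. }
assert (K := parallel_sum_le H (bop_Re A) (bop_Re B) a b t y z HRA HRB
  (bop_Re_selfadjoint H A) (bop_Re_selfadjoint H B) Ht).
rewrite <- Ex, !rip_bop_Re_diag, EA, EB, rip_scal_l in K.
apply Rle_trans with (1 := K); right.
transitivity (rip w (plus y z)); [rewrite rip_plus_r; field; lra | rewrite <- Ex; reflexivity].
Qed.

Theorem theorem2p4 :
  forall (H : Hilbert) (A B : bounded_op H) (l : R),
    accretive A -> accretive B -> 0 < l < 1 ->
    bop_ge (bop_Re (gmean l A B)) (gmean l (bop_Re A) (bop_Re B)).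
Proof.
intros H A B l HA HB Hl.
destruct (accretive_coercive H A HA) as [a [HRA HcA]].
destruct (accretive_coercive H B HB) as [b [HRB HcB]].
assert (SG : selfadjoint (gmean l (bop_Re A) (bop_Re B)))
  by (apply (gmean_selfadjoint H _ _ a b); trivial; apply bop_Re_selfadjoint).
assert (SR := bop_Re_selfadjoint H (gmean l A B)).
split.
- apply selfadjoint_rip; rewrite selfadjoint_rip in SG, SR; intros x y.
  set (X := bop_Re (gmean l A B)) in *; set (Y := gmean l (bop_Re A) (bop_Re B)) in *.
  change (rip (minus (X x) (Y x)) y = rip x (minus (X y) (Y y))).
  rewrite rip_minus_l, rip_minus_r, SG, SR; reflexivity.
- intros x.
  change (0 <= rip (minus (bop_Re (gmean l A B) x) (gmean l (bop_Re A) (bop_Re B) x)) x).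
  rewrite rip_minus_l, rip_bop_Re_diag; apply Rge_le, Rge_minus, Rle_ge.
  apply (gmean_form_le H (bop_Re A) (bop_Re B) A B a b a b); trivial.
  intros t Ht; apply (accretive_pencil_inv_ge H A B a b); trivial.
Qed.
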